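(* For any finite non-trivial group $G$ of linear fractional transformations of $\widehat{\mathbb{C}}$, there exists a finite subset $\alpha=\{z_1,z_2,\dots,z_n\}\subseteq\widehat{\mathbb{C}}$ such that $\mathcal{A}_\alpha\simeq G$.
   Context: $\widehat{\mathbb{C}}=\mathbb{C}\cup\{\infty\}$ is the Riemann sphere. For a finite subset $\alpha\subseteq\widehat{\mathbb{C}}$, $\mathcal{A}_\alpha$ is the group of linear fractional transformations $h$ with $h(\alpha)=\alpha$. $\simeq$ denotes isomorphism of groups. *)

(* Defs.v *)
From HB Require Import structures.
From mathcomp Require Import all_boot all_order all_algebra complex.
From mathcomp Require Import all_classical all_reals.
From mathcomp Require Import ring.

Set Implicit Arguments.
Unset Strict Implicit.
Unset Printing Implicit Defensive.

Import GRing.Theory.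
Local Open Scope ring_scope.
Local Open Scope classical_set_scope.

(* [None] is the point at infinity. *)
Definition riemann_sphere (R : realType) : Type := option R[i].

Section LinearFractionalTransformations.
Variable R : realType.
Local Notation C := R[i].
Local Notation sphere := (riemann_sphere R).

(* The usual conventions w / 0 = oo and oo |-> a / c are spelled out. *)
Definition linear_fractional (a b c d : C) (z : sphere) : sphere :=
  match z with
  | Some w => if c * w + d == 0 then None else Some ((a * w + b) / (c * w + d))
  | None => if c == 0 then None else Some (a / c)
  end.

Definition is_lft (f : sphere -> sphere) : Prop :=
  exists a b c d : C, a * d - b * c != 0 /\ f = linear_fractional a b c d.

Record lft := Lft { lft_fun :> sphere -> sphere; _ : `[< is_lft lft_fun >] }.

HB.instance Definition _ := [isSub for lft_fun].
HB.instance Definition _ := [Choice of lft by <:].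

Lemma lftP (f g : lft) : f =1 g -> f = g.
Proof. by move=> fg; apply/val_inj/funext. Qed.

Lemma linear_fractional_id : linear_fractional 1 0 0 1 = id.
Proof.
apply/funext => -[w|] /=; last by rewrite eqxx.
by rewrite mul0r add0r oner_eq0 mul1r addr0 divr1.
Qed.

Lemma linear_fractional_comp (a b c d a' b' c' d' : C) :
  a * d - b * c != 0 -> a' * d' - b' * c' != 0 ->
  linear_fractional a b c d \o linear_fractional a' b' c' d' =
  linear_fractional (a * a' + b * c') (a * b' + b * d')
                    (c * a' + d * c') (c * b' + d * d').
Proof.
move=> D D'; apply/funext => -[w|] /=; last first.
  have [c0|c0] /= := eqVneq c' 0.
    have a0 : a' != 0.
      by apply: contraNneq D' => ->; rewrite c0 mul0r mulr0 subrr.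
    rewrite c0 !mulr0 !addr0 mulf_eq0 (negPf a0) orbF.
    by have [//|cn0] := eqVneq c 0; congr Some; field; rewrite cn0 a0.
  have -> : c * (a' / c') + d = (c * a' + d * c') / c' by field.
  rewrite mulf_eq0 invr_eq0 (negPf c0) orbF.
  by have [//|n0] := eqVneq; congr Some; field; rewrite n0 c0.
have eN : (a * a' + b * c') * w + (a * b' + b * d')
        = a * (a' * w + b') + b * (c' * w + d') by ring.
have eD : (c * a' + d * c') * w + (c * b' + d * d')
        = c * (a' * w + b') + d * (c' * w + d') by ring.
rewrite eN eD; set u := a' * w + b'; set v := c' * w + d'.
have [v0|v0] /= := eqVneq v 0.
  have u0 : u != 0.
    apply: contraNneq D' => u0; move: u0 v0; rewrite /u /v => u0 v0.
    have ea : a' * v = 0 by rewrite /v v0 mulr0.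
    have ec : c' * u = 0 by rewrite /u u0 mulr0.
    have e0 : a' * d' - b' * c' = a' * v - c' * u by rewrite /u /v; ring.
    by rewrite e0 ea ec subrr.
  rewrite v0 !mulr0 !addr0 mulf_eq0 (negPf u0) orbF.
  by have [//|cn0] := eqVneq c 0; congr Some; field; rewrite cn0 u0.
have -> : c * (u / v) + d = (c * u + d * v) / v by field.
rewrite mulf_eq0 invr_eq0 (negPf v0) orbF.
by have [//|n0] := eqVneq; congr Some; field; rewrite n0 v0.
Qed.

Lemma is_lft_id : is_lft id.
Proof.
exists 1, 0, 0, 1; split; last by rewrite linear_fractional_id.
by rewrite mul0r subr0 mul1r oner_neq0.
Qed.

Lemma is_lft_comp (f g : sphere -> sphere) :
  is_lft f -> is_lft g -> is_lft (f \o g).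
Proof.
move=> [a [b [c [d [D ->]]]]] [a' [b' [c' [d' [D' ->]]]]].
rewrite linear_fractional_comp//; do 4 eexists; split; last by [].
have -> : forall x y z t x' y' z' t' : C,
  (x * x' + y * z') * (z * y' + t * t') - (x * y' + y * t') * (z * x' + t * z')
  = (x * t - y * z) * (x' * t' - y' * z') by move=> *; ring.
by rewrite mulf_neq0.
Qed.

Lemma is_lft_inv (f : sphere -> sphere) : is_lft f ->
  exists g : sphere -> sphere, [/\ is_lft g, g \o f = id & f \o g = id].
Proof.
move=> [a [b [c [d [D ->]]]]].
have D' : d * a - - b * - c != 0 by rewrite mulrNN mulrC.
have scalar (k : C) : k != 0 -> linear_fractional k 0 0 k = id.
  move=> k0; apply/funext => -[w|] /=; last by rewrite eqxx.
  by rewrite mul0r add0r (negPf k0) addr0 mulrAC divff// mul1r.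
exists (linear_fractional d (- b) (- c) a); split.
- by exists d, (- b), (- c), a.
- rewrite linear_fractional_comp// -[RHS](scalar _ D).
  by congr linear_fractional; ring.
- rewrite linear_fractional_comp// -[RHS](scalar _ D).
  by congr linear_fractional; ring.
Qed.

Definition lft_one : lft := Lft (asboolT is_lft_id).

Definition lft_comp (f g : lft) : lft :=
  Lft (asboolT (is_lft_comp (asboolW (valP f)) (asboolW (valP g)))).

Definition lft_inv (f : lft) : lft :=
  let s := cid (is_lft_inv (asboolW (valP f))) in
  Lft (asboolT (let: And3 p _ _ := svalP s in p)).

Lemma lft_compA : associative lft_comp.
Proof. by move=> f g h; apply: lftP. Qed.

Lemma lft_comp1f : left_id lft_one lft_comp.
Proof. by move=> f; apply: lftP. Qed.

Lemma lft_compf1 : right_id lft_one lft_comp.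
Proof. by move=> f; apply: lftP. Qed.

Lemma lft_compVf : left_inverse lft_one lft_inv lft_comp.
Proof.
move=> f; apply: lftP => z /=; case: cid => g [/= _ gf _].
exact: (congr1 (@^~ z) gf).
Qed.

Lemma lft_compfV : right_inverse lft_one lft_inv lft_comp.
Proof.
move=> f; apply: lftP => z /=; case: cid => g [/= _ _ fg].
exact: (congr1 (@^~ z) fg).
Qed.

HB.instance Definition _ := isGroup.Build lft
  lft_compA lft_comp1f lft_compf1 lft_compVf lft_compfV.

Definition lft_stab (alpha : set sphere) : set lft :=
  [set h : lft | h @` alpha = alpha].

Lemma lft_stab_group_closed (alpha : set sphere) :
  group_closed (mem (lft_stab alpha)).
Proof.
have comp (f g : lft) : (f * g)%g @` alpha = f @` (g @` alpha).
  by rewrite -image_comp.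
split=> [|f g]; first by rewrite !inE /lft_stab /= image_id.
rewrite !inE => fE gE.
have fgE : (f / g)%g @` alpha = (f / g)%g @` (g @` alpha) by rewrite [g @` _]gE.
by rewrite /lft_stab /mkset fgE -comp -mulgA mulVg mulg1.
Qed.

End LinearFractionalTransformations.

(* Isomorphism of A and B, meant for subgroups A and B: f only has to be
   multiplicative on A, and its values outside A are irrelevant. *)
Definition subgroup_isog (gT hT : groupType) (A : set gT) (B : set hT) : Prop :=
  exists f : gT -> hT,
    set_bij A B f /\ {in A &, {morph f : x y / (x * y)%g}}.

(* Main.v *)
Require Import Defs.
From HB Require Import structures.
From mathcomp Require Import all_boot all_order all_algebra complex.
From mathcomp Require Import all_classical all_reals.
From mathcomp Require Import ring.

Local Open Scope classical_set_scope.

(** The set [alpha] is built so that its stabilizer is [G] itself.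

    Start from a finite [G]-invariant set [A] with at least [#|G| + 3] points,
    and add to it the orbit [G w] of one further point.  A linear fractional
    [h] that preserves [A `|` G w] is injective, so it sends at most [#|G|]
    points of [A] into [G w], hence at least three points of [A] back into [A].
    As a linear fractional map is determined by its values at three points
    ([lft_eq3]), only finitely many maps [h] do that ([finite_three_point_maps]),
    and this finite list depends on [A] but not on [w].  Therefore [w] can be
    chosen afterwards so that no [h] in the list sends [w] into [A], and no
    [h] in the list agrees at [w] with an element of [G] other than [h]: each of
    these finitely many conditions excludes finitely many points.  For such a
    [w], a map [h] preserving [A `|` G w] satisfies [h w = g w] with [g] in [G],
    and so [h = g]. *)

(** Points are counted below by means of duplicate-free sequences of points,
    which require a boolean equality on the sphere. *)
HB.instance Definition _ (R : realType) :=
  Choice.copy (riemann_sphere R) (option R[i]).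

Section LinearFractionalMaps.
Set Implicit Arguments.
Unset Strict Implicit.
Variable R : realType.
Local Notation sphere := (riemann_sphere R).
Import GRing.Theory Num.Theory.
Local Open Scope ring_scope.

Lemma linear_fractional_fix_infty (a b c d : R[i]) :
  linear_fractional a b c d None = None -> c = 0.
Proof. by move=> /=; case: eqP. Qed.

Lemma linear_fractional_fix_finite (a b c d w : R[i]) :
  linear_fractional a b c d (Some w) = Some w ->
  c * w ^+ 2 + (d - a) * w - b = 0.
Proof.
move=> /=; have [//|nz] := eqVneq; case=> e.
have {}e : a * w + b = w * (c * w + d) by rewrite -[X in _ = X * _]e divfK.
have -> : c * w ^+ 2 + (d - a) * w - b = w * (c * w + d) - (a * w + b) by ring.
by rewrite e subrr.
Qed.

Lemma linear_fractional_scalar (a b c d : R[i]) :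
  a * d - b * c != 0 -> c = 0 -> d = a -> b = 0 ->
  linear_fractional a b c d = id.
Proof.
move=> D c0 da b0; move: D; rewrite c0 da b0 mulr0 subr0 => D.
have a0 : a != 0 by apply: contraNneq D => ->; rewrite mulr0.
apply/funext => -[w|] /=; last by rewrite eqxx.
by rewrite mul0r add0r (negPf a0) addr0 mulrAC divff// mul1r.
Qed.

Lemma affine_fix2 (a b c d u v : R[i]) : u != v ->
  linear_fractional a b c d None = None ->
  linear_fractional a b c d (Some u) = Some u ->
  linear_fractional a b c d (Some v) = Some v ->
  [/\ c = 0, d = a & b = 0].
Proof.
move=> uv /linear_fractional_fix_infty c0.
move=> /linear_fractional_fix_finite + /linear_fractional_fix_finite.
rewrite c0 !mul0r !add0r => eu ev.
have : (d - a) * (u - v) = 0.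
  have -> : (d - a) * (u - v) = ((d - a) * u - b) - ((d - a) * v - b) by ring.
  by rewrite eu ev subrr.
move/eqP; rewrite mulf_eq0 (subr_eq0 u) (negPf uv) orbF subr_eq0 => /eqP da.
split=> //; move: eu; rewrite da subrr mul0r sub0r => /eqP.
by rewrite oppr_eq0 => /eqP.
Qed.

(** The finite fixed points are roots of [c w^2 + (d - a) w - b], so three of
    them make all coefficients vanish; if the point at infinity is fixed then
    [c = 0] and two finite fixed points are enough. *)
Lemma linear_fractional_fix3 (a b c d : R[i]) (x y z : sphere) :
  a * d - b * c != 0 -> uniq [:: x; y; z] ->
  linear_fractional a b c d x = x -> linear_fractional a b c d y = y ->
  linear_fractional a b c d z = z -> linear_fractional a b c d = id.
Proof.
move=> D; rewrite /= !inE negb_or andbT => /andP[/andP[xy xz] yz] fx fy fz.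
suff [c0 da b0] : [/\ c = 0, d = a & b = 0].
  exact: linear_fractional_scalar.
case: x y z xy xz yz fx fy fz => [x|] [y|] [z|] //= xy xz yz fx fy fz.
- move: fx fy fz => /linear_fractional_fix_finite fx.
  move=> /linear_fractional_fix_finite fy /linear_fractional_fix_finite fz.
  pose p := Poly [:: - b; d - a; c].
  have rootp w : c * w ^+ 2 + (d - a) * w - b = 0 -> root p w.
    by move=> e; apply/eqP; rewrite horner_Poly /= -[RHS]e; ring.
  have p0 : p = 0.
    apply/eqP; apply: contraT => /max_poly_roots - /(_ [:: x; y; z]).
    rewrite /= !rootp//= !inE negb_or xy xz yz => /(_ isT isT).
    by rewrite ltnNge size_Poly.
  have coef i : [:: - b; d - a; c]`_i = 0 by rewrite -coef_Poly -/p p0 coef0.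
  split; first exact: (coef 2).
    by apply/eqP; rewrite -subr_eq0; apply/eqP/(coef 1).
  by apply/eqP; rewrite -oppr_eq0; apply/eqP/(coef 0).
- exact: (@affine_fix2 a b c d x y).
- exact: (@affine_fix2 a b c d x z).
- exact: (@affine_fix2 a b c d y z).
Qed.

Lemma lft_inj (f : lft R) : injective f.
Proof.
move=> x y e; have K z : (f^-1 * f)%g z = z by rewrite mulVg.
by rewrite -(K x) -(K y); congr (f^-1%g _).
Qed.

(** The map [g^-1 * f] fixes the three points, so it is the identity. *)
Lemma lft_eq3 (f g : lft R) (x y z : sphere) : uniq [:: x; y; z] ->
  f x = g x -> f y = g y -> f z = g z -> f = g.
Proof.
move=> u fx fy fz; apply: (mulgI g^-1%g); rewrite mulVg.
have fixg w : f w = g w -> (g^-1 * f)%g w = w.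
  move=> e; have -> : (g^-1 * f)%g w = (g^-1 * g)%g w by congr (g^-1%g _).
  by rewrite mulVg.
move: (fixg _ fx) (fixg _ fy) (fixg _ fz).
case: (g^-1 * f)%g => h /= hlft hx hy hz.
apply: lftP => w /=; have [a [b [c [d [D hE]]]]] := asboolW hlft.
by move: hx hy hz; rewrite hE => hx hy hz; rewrite (linear_fractional_fix3 D u).
Qed.

Lemma uniq_triple (T : eqType) (x y z : T) (s : seq T) :
  uniq [:: x, y, z & s] -> uniq [:: x; y; z].
Proof. by rewrite (cat_uniq [:: x; y; z] s) => /andP[]. Qed.

Lemma finite_coincidence (f g : lft R) : f != g ->
  finite_set [set z | f z = g z].
Proof.
move=> fg; apply: contrapT => /infinite_set_fset - /(_ 3%N)[B BS].
have {}BS x : x \in finmap.enum_fset B -> f x = g x by apply: BS.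
have := finmap.fset_uniq B.
case: (finmap.enum_fset B) BS => [|x [|y [|z s]]] //= BS u _.
apply: (negP fg); apply/eqP; apply: (@lft_eq3 f g x y z).
- exact: uniq_triple u.
- by apply: BS; rewrite !inE eqxx.
- by apply: BS; rewrite !inE eqxx ?orbT.
- by apply: BS; rewrite !inE eqxx ?orbT.
Qed.

(** For each choice of three distinct points of [A], evaluation at them is
    injective on linear fractional maps, and the maps at hand send them into the
    finite set [A ^ 3]. *)
Lemma finite_three_point_maps (A : set sphere) : finite_set A ->
  finite_set [set h : lft R | exists s : seq sphere,
    [/\ uniq s, (2 < size s)%N & forall x, x \in s -> A x /\ A (h x)]].
Proof.
move=> Afin.
pose maps (t : sphere * sphere * sphere) : set (lft R) :=
  [set h | [/\ A (h t.1.1), A (h t.1.2) & A (h t.2)]].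
pose triples := (A `*` A `*` A) `&` [set t | uniq [:: t.1.1; t.1.2; t.2]].
apply: (@sub_finite_set _ _ (\bigcup_(t in triples) maps t)).
  move=> h [[|x [|y [|z s]]] [] // u _ hs].
  have [[Ax Ahx] [Ay Ahy] [Az Ahz]] :
      [/\ A x /\ A (h x), A y /\ A (h y) & A z /\ A (h z)].
    by split; apply: hs; rewrite !inE eqxx ?orbT.
  exists (x, y, z) => //; split=> //; exact: uniq_triple u.
apply: bigcup_finite => [|[[x y] z] [_ u]].
  by apply: finite_setIl; do 2?apply: finite_setX.
pose ev (h : lft R) := (h x, h y, h z).
apply: (@sub_finite_set _ _ (ev @^-1` (A `*` A `*` A))).
  by move=> h [].
apply: finite_preimage; last by do 2?apply: finite_setX.
by move=> f g _ _ [fx fy fz]; apply: (@lft_eq3 f g x y z).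
Qed.

Lemma sphere_points (n : nat) :
  exists s : seq sphere, uniq s /\ size s = n.
Proof.
exists [seq Some i%:R | i <- iota 0 n]; rewrite size_map size_iota; split=> //.
rewrite map_inj_uniq ?iota_uniq// => i j [] /eqP.
by rewrite eqr_nat => /eqP.
Qed.

Lemma exists_sphere_notin (B : set sphere) : finite_set B -> exists w, ~ B w.
Proof.
move=> /finite_seqP[s ->]; apply: contrapT => all_s.
have [t [ut st]] := sphere_points (size s).+1.
suff /(uniq_leq_size ut) : {subset t <= s} by rewrite st ltnn.
by move=> x _; apply: contrapT => xs; apply: all_s; exists x.
Qed.

(** Pigeonhole: [h] is injective, so at most [size s] of the points of [X] go
    into [s], and the others, at least three of them, go into [A]. *)
Lemma stab_three_points (A : set sphere) (X s : seq sphere) (h : lft R) :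
  uniq X -> (size s + 3 <= size X)%N -> [set` X] `<=` A ->
  h \in lft_stab (A `|` [set` s]) ->
  exists t : seq sphere,
    [/\ uniq t, (2 < size t)%N & forall x, x \in t -> A x /\ A (h x)].
Proof.
move=> uX sX XA; rewrite inE => hS; pose p x := h x \in s.
exists [seq x <- X | ~~ p x]; split; first exact: filter_uniq.
- have : (size [seq h x | x <- X & p x] <= size s)%N.
    apply: uniq_leq_size.
      by rewrite map_inj_uniq ?filter_uniq//; exact: lft_inj.
    by move=> _ /mapP[x + ->]; rewrite mem_filter => /andP[].
  rewrite size_map size_filter => ps.
  rewrite size_filter -(leq_add2l (count p X)) count_predC.
  by apply: leq_trans sX; rewrite leq_add2r.
- move=> x; rewrite mem_filter => /andP[/negP px xX]; split; first exact: XA.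
  have : (A `|` [set` s]) (h x) by rewrite -hS; exists x => //; left; exact: XA.
  by case.
Qed.

(** Only finitely many points are excluded, as two distinct linear fractional
    maps agree at finitely many points. *)
Lemma exists_generic_point (A : set sphere) (F G : set (lft R)) :
  finite_set A -> finite_set F -> finite_set G ->
  exists w, forall h, F h -> ~ A (h w) /\ forall g, G g -> h w = g w -> h = g.
Proof.
move=> Afin Ffin Gfin.
pose bad (h : lft R) := h @^-1` A `|`
  \bigcup_(g in G `&` [set g | h != g]) [set z | h z = g z].
have [w badw] : exists w, ~ (\bigcup_(h in F) bad h) w.
  apply/exists_sphere_notin/bigcup_finite => // h _; rewrite finite_setU; split.
    by apply: finite_preimage => // x y _ _; exact: lft_inj.
  apply: bigcup_finite => [|g [_ hg]]; first exact: finite_setIl.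
  exact: finite_coincidence.
exists w => h Fh; split=> [Ahw|g Gg hgw].
  by apply: badw; exists h => //; left.
apply/eqP/negPn/negP => hg; apply: badw; exists h => //; right.
by exists g.
Qed.

Lemma invariant_sub_stab (G : set (lft R)) (A : set sphere) :
  group_closed (mem G) -> (forall g x, G g -> A x -> A (g x)) ->
  G `<=` lft_stab A.
Proof.
move=> Ggrp GA g Gg.
apply/seteqP; split=> [_ [x Ax <-]|x Ax]; first exact: GA.
exists (g^-1%g x).
  apply: GA => //; rewrite -in_setE.
  by apply: (group_closedV Ggrp); rewrite inE.
by have -> : g (g^-1%g x) = (g * g^-1)%g x by []; rewrite mulgV.
Qed.

(** The set is [A `|` G w], where [A] is the union of the [G]-orbits of
    [#|G| + 3] points and [w] is generic with respect to the maps that send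
    three points of [A] into [A]. *)
Lemma exists_stab_eq (G : set (lft R)) : group_closed (mem G) -> finite_set G ->
  exists alpha : set sphere, finite_set alpha /\ lft_stab alpha = G.
Proof.
move=> Ggrp Gfin; have [Gs GE] := (finite_seqP _).1 Gfin.
have inG g : (g \in Gs) = (g \in G) by rewrite GE mem_setE.
have GM g h x : G g -> G h -> exists2 k, G k & g (h x) = k x.
  move=> Gg Gh; exists (g * h)%g => //; rewrite -in_setE.
  by apply: (group_closedM Ggrp); rewrite inE.
have G1 : G 1%g by rewrite -in_setE; case: Ggrp.
have [X [uX sX]] := sphere_points (size Gs + 3).
pose orb x : seq sphere := [seq (g : lft R) x | g <- Gs].
have orbP x y : reflect (exists2 g, G g & y = g x) (y \in orb x).
  by apply: (iffP mapP) => -[g Gg ->]; exists g => //; move: Gg; rewrite inG inE.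
have GorbP g x y : G g -> y \in orb x -> g y \in orb x.
  move=> Gg /orbP[h Gh ->]; have [k Gk ->] := GM g h x Gg Gh.
  by apply/orbP; exists k.
pose A : set sphere := \bigcup_(x in [set` X]) [set` orb x].
have Afin : finite_set A.
  by apply: bigcup_finite => // *; exact: finite_seq.
have XA : [set` X] `<=` A.
  by move=> x xX; exists x => //; apply/orbP; exists 1%g.
have [w wgen] := exists_generic_point Afin (finite_three_point_maps Afin) Gfin.
exists (A `|` [set` orb w]); split.
  by rewrite finite_setU; split=> //; exact: finite_seq.
apply/seteqP; split=> [h hS|].
  have hF := @stab_three_points A X (orb w) h uX.
  rewrite sX size_map in hF.
  have [hwA hwG] := wgen h (hF (leqnn _) XA (mem_set hS)).
  have : (A `|` [set` orb w]) (h w).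
    by rewrite -hS; exists w => //; right; apply/orbP; exists 1%g.
  by case=> // /orbP[g Gg /(hwG g Gg) ->].
apply: invariant_sub_stab => // g x Gg [[y yX xy]|xw].
- by left; exists y => //; exact: GorbP.
- by right; exact: GorbP.
Qed.

End LinearFractionalMaps.

Theorem theorem24 (R : realType) (G : set (lft R)) :
  group_closed (mem G) -> finite_set G -> G != [set 1%g] ->
  exists alpha : set (riemann_sphere R),
    finite_set alpha /\ subgroup_isog (lft_stab alpha) G.
Proof.
move=> Ggrp Gfin _.
have [alpha [alpha_fin alphaE]] := exists_stab_eq Ggrp Gfin.
exists alpha; split=> //; rewrite alphaE; exists id; split=> //.
by split=> // g Gg; exists g.
Qed.
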